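(* Let $n\ge 2$, $d\geq 0$, and let $C$ be a symmetric $n\times n$ circulant matrix with generator $(c_0,\ldots,c_{n-1})$ such that $c_0=d$, $c_j\in\{1,-1\}$ for $j=1,\ldots,n-1$, and $CC^T=(d^2+n-1)I$. Then $n=2(d+1)$.
   Context: A circulant matrix of order $n$ with generator $(c_0,c_1,\ldots,c_{n-1})$ is the $n\times n$ matrix whose entry in row $i$ and column $j$ (indices $0,\ldots,n-1$) is $c_{(j-i)\bmod n}$. *)

(* Defs.v *)
From HB Require Import structures.
From mathcomp Require Import all_boot all_order all_algebra.
From mathcomp Require Import reals.

Set Implicit Arguments.
Unset Strict Implicit.
Unset Printing Implicit Defensive.

Import Order.TTheory GRing.Theory Num.Theory.

Local Open Scope ring_scope.

(* Subtraction on nat is truncated: n is added first so that, for i, j < n,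
   the index is the residue of the integer j - i modulo n. *)
Definition circulant_mx (R : realType) (n : nat) (c : n.-tuple R) : 'M[R]_n :=
  \matrix_(i < n, j < n) c`_((j + n - i) %% n)%N.

(* Main.v *)
(* Let A = 2C. Orthogonality of the first two rows gives 2d = -c_1 S with S a sum
   of n - 2 signs, so A is an integer matrix and 2d <= n - 2. The eigenvalues
   l_k = sum_j a_j z^(jk), z a primitive n-th root of unity, satisfy l_k^2 = m^2,
   where m = l_0 is an integer and m^2 = (2d)^2 + 4(n - 1).

   It suffices to prove n | m: then m^2 >= n^2 forces 2d >= n - 2. The eigenvalues
   being rational, Galois conjugation gives a_(tj) = a_j for t prime to n. Let q be
   the p-part of n and k a multiple of q, and put f = sum of a_j z^(jk) over the j
   congruent to 1 mod q. Galois invariance yields l_k - l_(k + n/p) = q f, and f is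
   nonzero for some k by Fourier inversion. Then q f = 2m or -2m, and f/2 is an
   algebraic integer because a_j is even for j <> 0; hence q | m. *)

Require Import Defs.
From HB Require Import structures.
From mathcomp Require Import all_boot all_order all_algebra all_field.
From mathcomp Require Import reals.
From mathcomp Require Import ring lra zify.

Set Implicit Arguments.
Unset Strict Implicit.
Unset Printing Implicit Defensive.

Import Order.TTheory GRing.Theory Num.Theory.

Local Open Scope ring_scope.

(** * Roots of unity, Fourier inversion and Galois invariance *)

Lemma eqn_modMl_coprime (m i x y : nat) : coprime m i ->
  (i * x == i * y %[mod m])%N = (x == y %[mod m])%N.
Proof.
move=> mi; wlog le_yx : x y / (y <= x)%N => [hw|].
  by case/orP: (leq_total y x) => /hw // h; rewrite eq_sym h eq_sym.
by rewrite !eqn_mod_dvd ?leq_mul2l ?le_yx ?orbT // -mulnBr Gauss_dvdr.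
Qed.

Lemma sum_unity_root_expr (F : fieldType) (n : nat) (w : F) :
  w ^+ n = 1 -> \sum_(k < n) w ^+ k = if w == 1 then n%:R else 0.
Proof.
move=> wn1; case: eqVneq => [->|w1].
  by rewrite (eq_bigr (fun=> 1)) ?sumr_const ?card_ord // => k _; rewrite expr1n.
apply: (mulfI (_ : w - 1 != 0)); first by rewrite subr_eq0.
by rewrite -subrX1 wn1 subrr mulr0.
Qed.

(** The eigenvalue l_k of the circulant matrix with first row [a]. *)
Definition dft (n : nat) (z : algC) (a : nat -> int) (k : nat) : algC :=
  \sum_(j < n) (a j)%:~R * z ^+ (j * k).

Lemma prim_root_neq0 (F : fieldType) (n : nat) (z : F) : n.-primitive_root z -> z != 0.
Proof.
move=> zP; apply: contra_eq_neq (prim_expr_order zP) => ->.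
by rewrite expr0n gtn_eqF ?(prim_order_gt0 zP) // eq_sym oner_eq0.
Qed.

Lemma dft_inv n z a i : n.-primitive_root z ->
  \sum_(k < n) dft n z a k / z ^+ (i * k) = n%:R * (a (i %% n)%N)%:~R.
Proof.
move=> zP; have n_gt0 := prim_order_gt0 zP; have zn1 := prim_expr_order zP.
have z0 := prim_root_neq0 zP.
under eq_bigr do rewrite mulr_suml.
rewrite exchange_big /= (bigD1 (Ordinal (ltn_pmod i n_gt0))) //= [X in _ + X]big1.
  rewrite addr0 -[n in n%:R]card_ord -sumr_const mulr_suml; apply: eq_bigr => k _.
  by rewrite !exprM (prim_expr_mod zP) mulfK ?expf_neq0 // mul1r.
move=> j ji.
under eq_bigr do rewrite -mulrA !exprM -exprVn -exprMn.
rewrite -mulr_sumr sum_unity_root_expr; last first.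
  by rewrite exprMn exprVn -!exprM ![(_ * n)%N]mulnC !exprM zn1 !expr1n invr1 mulr1.
case: eqP => [/(canRL (mulfVK (expf_neq0 _ z0)))|_]; last by rewrite mulr0.
rewrite mul1r => /eqP; rewrite (eq_prim_root_expr zP) modn_small // => /eqP e.
by case/eqP: ji; apply: val_inj.
Qed.

(* The Galois group of Q(z)/Q fixes the spectrum, hence permutes the Fourier
   inversion formula. *)
Lemma rational_dft_const n z a i t : n.-primitive_root z ->
  (forall k, dft n z a k \in Crat) -> coprime t n ->
  a ((t * i) %% n)%N = a (i %% n)%N.
Proof.
move=> zP ratl tn; have n_gt0 := prim_order_gt0 zP; have zn1 := prim_expr_order zP.
have [u uP] := Qn_aut_exists tn.
apply: (@intr_inj algC); apply: (mulfI (_ : n%:R != 0 :> algC)).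
  by rewrite pnatr_eq0 -lt0n.
rewrite -!(dft_inv _ _ zP).
transitivity (u (\sum_(k < n) dft n z a k / z ^+ (i * k))); last first.
  by rewrite dft_inv // rmorphM rmorph_nat rmorph_int.
rewrite rmorph_sum; apply: eq_bigr => k _.
rewrite rmorphM fmorphV aut_Crat // uP -?exprM 1?[(_ * n)%N]mulnC ?exprM ?zn1 ?expr1n //.
by rewrite -!exprM; congr (_ / z ^+ _); lia.
Qed.

(** * Eigenvalues split by residue classes modulo the p-part [q] of [n] *)

Section PrimePower.
Variables (n p q u : nat) (z : algC) (a : nat -> int).
Hypotheses (zP : n.-primitive_root z) (ratl : forall k, dft n z a k \in Crat).
Hypotheses (pP : prime p) (nqu : n = (q * u)%N) (qp : p.-nat q) (q1 : (1 < q)%N)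
  (qu : coprime q u).

Let f (k i : nat) : algC := \sum_(j < n | (j %% q == i)%N) (a j)%:~R * z ^+ (j * (q * k)).

Let n_gt0 := prim_order_gt0 zP.
Let zn1 := prim_expr_order zP.
Let z0 := prim_root_neq0 zP.
Let u_gt0 : (0 < u)%N. Proof. by move: n_gt0; rewrite nqu; case: (u); rewrite ?muln0. Qed.
Let pq : (p %| q)%N.
Proof.
by case/p_natP: qp q1 => -[|s] -> //; rewrite expnS dvdn_mulr.
Qed.

(** Take t congruent to i mod [q] and to 1 mod [u]. Multiplication by t carries the class of 1 to
    that of i. It preserves [a] by Galois invariance, and preserves z^(jqk), which depends only on j
    mod [u]. *)
Lemma coset_sum_const k i : (i < q)%N -> coprime p i -> f k i = f k 1.
Proof.
move=> iq pi.
have qi : coprime q i by case/p_natP: qp => s ->; rewrite coprimeXl.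
pose t := chinese q u i 1.
have tq : t = i %[mod q] by apply: chinese_modl.
have tu : t = 1 %[mod u] by apply: chinese_modr.
have tn : coprime t n.
  by rewrite nqu coprimeMr -coprime_modl tq coprime_modl coprime_sym qi /=
    -coprime_modl tu coprime_modl coprime1n.
pose h (j : 'I_n) := Ordinal (ltn_pmod (t * j) n_gt0).
have h_inj : injective h.
  move=> j j' /(congr1 val) /= /eqP; rewrite eqn_modMl_coprime 1?coprime_sym //.
  by rewrite !modn_small // => /eqP; apply: val_inj.
rewrite /f (reindex_inj h_inj) /=; apply: eq_big => [j|j _].
  rewrite modn_dvdm ?nqu ?dvdn_mulr // -modnMml tq modnMml.
  rewrite -[X in _ == X](modn_small iq) -{2}[i]muln1 eqn_modMl_coprime //.
  by rewrite [(1 %% q)%N]modn_small.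
congr (_ * _).
  by rewrite (rational_dft_const _ zP) // modn_small.
apply/eqP; rewrite (eq_prim_root_expr zP) modnMml.
have -> : (t * j * (q * k) = q * (t * (j * k)))%N by lia.
have -> : (j * (q * k) = q * (j * k))%N by lia.
by move: (j * k)%N => x; rewrite nqu -!muln_modr -modnMml tu modnMml mul1n.
Qed.

(** Shifting the index by n/p multiplies the j-th term by eta^j, with eta a primitive p-th root of
    unity. As p divides [q], this factor is constant on classes mod [q]; the factors 1 - eta^i sum
    to [q]. *)
Lemma dft_sub_eq k :
  dft n z a (q * k) - dft n z a (q * k + n %/ p) = q%:R * f k 1.
Proof.
pose eta := z ^+ (n %/ p).
have pn : (p %| n)%N by rewrite nqu dvdn_mulr.
have etaP : p.-primitive_root eta := dvdn_prim_root zP pn.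
have eta1 : eta != 1.
  have := eq_prim_root_expr etaP 1 0; rewrite expr1 expr0 => ->.
  by rewrite mod0n modn_small ?prime_gt1.
have etaq : eta ^+ q = 1 by apply/eqP; rewrite -(prim_order_dvd etaP).
have etaj j : eta ^+ j = eta ^+ (j %% q).
  by rewrite -(prim_expr_mod etaP) -(prim_expr_mod etaP (j %% q)) modn_dvdm.
(* The factor [1 - eta ^+ i] kills every residue i divisible by p, so only the
   classes on which f is constant contribute. *)
transitivity (\sum_(i < q) (1 - eta ^+ i) * f k i); last first.
  transitivity (\sum_(i < q) (1 - eta ^+ i) * f k 1).
    apply: eq_bigr => i _; have [pi|pi] := boolP (coprime p i).
      by rewrite coset_sum_const.
    rewrite prime_coprime // negbK (prim_order_dvd etaP) in pi.
    by rewrite (eqP pi) subrr !mul0r.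
  rewrite -mulr_suml sumrB sum_unity_root_expr // (negPf eta1) subr0.
  by rewrite sumr_const card_ord.
rewrite /dft -sumrB.
rewrite (partition_big (fun j : 'I_n => Ordinal (ltn_pmod j (ltnW q1))) xpredT) //=.
apply: eq_bigr => i _; rewrite mulr_sumr; apply: eq_big => [j|j /eqP <-] //=.
rewrite -etaj mulnDr exprD -!exprM [(n %/ p * j)%N]mulnC; ring.
Qed.

(** Fourier inversion over Z/u with the root z^q: by the Chinese remainder theorem, 1 is the only
    index of its class mod [q] that is congruent to 1 mod [u], so vanishing of all [f k 1] would
    force [a 1] = 0. *)
Lemma coset_sum_neq0 : a 1 != 0 -> exists k, f k 1 != 0.
Proof.
move=> a1; have [/existsP[k fk]|/existsPn f0] := boolP [exists k : 'I_u, f k 1 != 0].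
  by exists k.
have zqP : u.-primitive_root (z ^+ q).
  by rewrite -[q](mulnK _ u_gt0) -nqu; apply: (dvdn_prim_root zP); rewrite nqu dvdn_mull.
have n1 : (1 < n)%N by rewrite nqu (leq_trans q1) // leq_pmulr.
case/eqP: a1; apply: (@intr_inj algC); apply: (mulfI (_ : u%:R != 0 :> algC)).
  by rewrite pnatr_eq0 -lt0n.
rewrite mulr0.
transitivity (\sum_(k < u) f k 1 / (z ^+ q) ^+ k); last first.
  by apply: big1 => k _; have := f0 k; rewrite negbK => /eqP ->; rewrite mul0r.
under eq_bigr do rewrite /f mulr_suml.
rewrite exchange_big /= (bigD1 (Ordinal n1)) /=; last by rewrite modn_small.
rewrite [X in _ + X]big1 ?addr0 => [|j /andP[jq j1]].
  rewrite -[u in u%:R]card_ord -sumr_const mulr_suml; apply: eq_bigr => k _.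
  by rewrite mul1n exprM mulfK ?expf_neq0 ?mul1r.
under eq_bigr do rewrite mulnA [(j * q)%N]mulnC !exprM -mulrA -exprVn -exprMn.
rewrite -mulr_sumr sum_unity_root_expr; last first.
  by rewrite exprMn exprVn (exprAC _ j u) (prim_expr_order zqP) expr1n invr1 mulr1.
case: eqP => [/(canRL (mulfVK (expf_neq0 _ z0)))|_]; last by rewrite mulr0.
rewrite mul1r -[RHS]expr1 => /eqP; rewrite (eq_prim_root_expr zqP) => ju.
have : (j == 1 %[mod q * u])%N by rewrite chinese_remainder // ju (eqP jq) modn_small ?eqxx.
by rewrite -nqu !modn_small // => /eqP j1'; case/eqP: j1; apply: val_inj.
Qed.
End PrimePower.

(** * Integer circulants whose square is scalar: divisibility of the row sum *)

Lemma part_dvd_dft (n p : nat) (z : algC) (a e : nat -> int) (m : int) :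
    n.-primitive_root z -> p \in \pi(n) ->
    (forall k, dft n z a k ^+ 2 = m%:~R ^+ 2) ->
    (forall j, (0 < j < n)%N -> a j = 2 * e j) -> a 1 != 0 ->
  (n`_p %| `|m|)%N.
Proof.
move=> zP pn am ae a1.
have dm k : dft n z a k = m%:~R \/ dft n z a k = - m%:~R.
  by have /eqP := am k; rewrite eqf_sqr => /orP[] /eqP; [left|right].
have ratl k : dft n z a k \in Crat.
  by case: (dm k) => ->; rewrite ?rpredN ?rpred_int.
have n_gt0 := prim_order_gt0 zP.
have pP : prime p by move: pn; rewrite mem_primes => /andP[].
have nqu : n = (n`_p * n`_p^')%N by rewrite partnC.
have qp := part_pnat p n.
have qu : coprime n`_p n`_p^' := coprime_partC p n n.
have q1 : (1 < n`_p)%N by rewrite p_part_gt1.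
have [k] := coset_sum_neq0 zP nqu q1 qu a1.
set f := \sum_(j < n | _) _ => f0.
pose h := \sum_(j < n | (j %% n`_p == 1)%N) (e j)%:~R * z ^+ (j * (n`_p * k)).
(* The class of 1 avoids the index 0, the only one where [a] may be odd. *)
have fh : f = 2 * h.
  rewrite /f mulr_sumr; apply: eq_bigr => j j1.
  rewrite ae ?rmorphM ?mulrA // ltn_ord andbT lt0n.
  by apply: contraTneq j1 => ->; rewrite mod0n.
have h0 : h != 0 by apply: contraNneq f0; rewrite fh => ->; rewrite mulr0.
have hA : h \in Aint.
  apply: rpred_sum => j _; apply: rpredM; first exact: Aint_int.
  by apply: rpredX; apply: Aint_prim_root zP.
have q0 : (n`_p)%:R != 0 :> algC by rewrite pnatr_eq0 -lt0n part_gt0.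
have qh0 : (n`_p)%:R * h != 0 by rewrite mulf_neq0.
(* The two eigenvalues are [m] up to sign and differ, so they are opposite. *)
have qh : (n`_p)%:R * h = m%:~R \/ (n`_p)%:R * h = - m%:~R.
  have := dft_sub_eq zP ratl pP nqu qp q1 qu k; rewrite -/f fh => E.
  have {}E : (n`_p)%:R * h = (dft n z a (n`_p * k) - dft n z a (n`_p * k + n %/ p)) / 2.
    by rewrite E; field.
  move: qh0; rewrite E.
  case: (dm (n`_p * k)%N) => ->; case: (dm (n`_p * k + n %/ p)%N) => ->;
    rewrite ?subrr ?mul0r ?eqxx // => _; [left|right]; by field.
have qhQ : (n`_p)%:R * h \in Crat by case: qh => ->; rewrite ?rpredN rpred_int.
(* A rational algebraic integer is an integer. *)
have hZ : h \in Num.int.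
  by apply: Cint_rat_Aint => //; rewrite -(mulKf q0 h) rpredM ?rpredV ?rpred_nat.
case/intrP: hZ qh => x ->; rewrite -[(n`_p)%:R]mulrz_nat -rmorphM -rmorphN /=.
by case=> /intr_inj E; [rewrite -E | rewrite -abszN -E]; rewrite abszM natz dvdn_mulr.
Qed.

(** The vector of the z^(jk) is an eigenvector; its coordinate 0 is 1, so the scalars can be
    compared there. *)
Lemma int_circulant_dft_sq (n : nat) (z : algC) (a : nat -> int) (N : int) :
    n.-primitive_root z ->
    let A := \matrix_(i < n, j < n) a ((j + n - i) %% n)%N in
    A *m A = N%:M ->
  forall k, dft n z a k ^+ 2 = N%:~R.
Proof.
move=> zP A AA k; have n_gt0 := prim_order_gt0 zP.
pose v : 'cV[algC]_n := \col_j z ^+ (j * k).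
have Av : map_mx intr A *m v = dft n z a k *: v.
  apply/colP => i; rewrite !mxE mulr_suml.
  pose h (l : 'I_n) := Ordinal (ltn_pmod (l + i) n_gt0).
  have h_inj : injective h.
    move=> l l' /(congr1 val) /eqP /=; rewrite eqn_modDr !modn_small // => /eqP.
    exact: val_inj.
  rewrite (reindex_inj h_inj) /=; apply: eq_bigr => l _; rewrite !mxE /=.
  have -> : (((l + i) %% n + n - i) %% n)%N = l.
    rewrite -addnBA 1?ltnW // modnDml -addnA subnKC 1?ltnW //.
    by rewrite modnDr modn_small.
  by rewrite exprM (prim_expr_mod zP) -exprM mulnDl exprD mulrA.
have : map_mx intr A *m (map_mx intr A *m v) = N%:~R *: v.
  by rewrite mulmxA -map_mxM AA map_scalar_mx mul_scalar_mx.
rewrite Av -scalemxAr Av scalerA => /colP /(_ (Ordinal n_gt0)).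
by rewrite !mxE /= mul0n expr0 !mulr1.
Qed.

Lemma int_circulant_order_le (n : nat) (a e : nat -> int) (N : int) :
    (0 < n)%N -> 0 < N -> (forall j, (0 < j < n)%N -> a j = 2 * e j) -> a 1 != 0 ->
    let A := \matrix_(i < n, j < n) a ((j + n - i) %% n)%N in
    A *m A = N%:M ->
  n%:Z ^+ 2 <= N.
Proof.
move=> n_gt0 N_gt0 ae a1 A AA; have [z zP] := C_prim_root_exists n_gt0.
have lamN := int_circulant_dft_sq zP AA.
(* The row sum is the eigenvalue at k = 0. *)
pose m := \sum_(j < n) a j.
have m2 : m ^+ 2 = N.
  apply: (@intr_inj algC); rewrite -(lamN 0%N) rmorphXn /= rmorph_sum /=.
  by congr (_ ^+ 2); apply: eq_bigr => j _; rewrite muln0 mulr1.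
have nm : (n %| `|m|)%N.
  apply/dvdn_partP => // p pn; apply: part_dvd_dft zP pn _ ae a1 => k.
  by rewrite lamN -m2 rmorphXn.
have m_gt0 : (0 < `|m|)%N.
  by rewrite absz_gt0; apply: contraTneq N_gt0 => m0; rewrite -m2 m0 expr0n.
by rewrite -m2 -[m ^+ 2]real_normK ?num_real // -abszE; have := dvdn_leq m_gt0 nm; nia.
Qed.

(** * Reduction to the integer matrix 2C *)

Theorem theorem4p9 (R : realType) (n : nat) (d : R) (c : n.-tuple R)
    (C : 'M[R]_n) :
  (2 <= n)%N ->
  0 <= d ->
  C = circulant_mx c ->
  C^T = C ->
  c`_0 = d ->
  (forall j : nat, (1 <= j <= n.-1)%N -> c`_j = 1 \/ c`_j = -1) ->
  C *m C^T = (d ^+ 2 + n%:R - 1)%:M ->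
  n%:R = 2 * (d + 1).
Proof.
case: n c C => [|[|m]] // c C _ d0 Cc Csym c0 cpm CC.
have Cij i j : C i j = c`_((j + m.+2 - i) %% m.+2) by rewrite Cc mxE.
pose e (j : nat) : int := if c`_j == 1 then 1 else -1.
have ce (j : nat) : (0 < j < m.+2)%N -> c`_j = (e j)%:~R.
  move=> /cpm; rewrite /e => -[->|->]; first by rewrite eqxx.
  by rewrite eqNr oner_eq0.
have e2 j : e j * e j = 1 by rewrite /e; case: ifP.
have cm : c`_m.+1 = c`_1.
  have := congr1 (fun B : 'M_m.+2 => B (Ordinal (isT : 1 < m.+2)%N) ord0) Csym.
  (* Symmetry compares the entries (1,0) and (0,1). *)
  rewrite mxE !Cij /= subn0 add0n subSS subn0 [(m.+1 %% _)%N]modn_small //.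
  by rewrite modnDr modn_small.
(* Columns 2 to n - 1 of the inner product of rows 0 and 1; columns 0 and 1 give d c_1 each. *)
pose S := \sum_(l < m) e l.+2 * e l.+1.
have S_le : `|S| <= m%:Z.
  apply: le_trans (ler_norm_sum _ _ _) _.
  rewrite -[m in leRHS]card_ord -natz -sumr_const; apply: ler_sum => l _.
  by rewrite normrM /e; do 2?case: ifP.
pose D := - e 1 * S.
have dD : 2 * d = D%:~R.
  have /matrixP /(_ ord0 (Ordinal (isT : 1 < m.+2)%N)) := CC.
  rewrite !mxE /= mulr0n !big_ord_recl !mxE !Cij /=.
  rewrite !(subn0, modnn, add0n, subSS, modnDr) c0 modn_small // cm.
  have -> : \sum_(l < m) C ord0 (lift ord0 (lift ord0 l)) *
      C^T (lift ord0 (lift ord0 l)) (Ordinal (isT : 1 < m.+2)%N) = S%:~R.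
    rewrite rmorph_sum /=; apply: eq_bigr => l _; rewrite mxE !Cij /= /bump /= !add1n.
    rewrite subn0 modnDr addSn subSS subn0 modnDr rmorphM /=.
    have lm := ltn_ord l; rewrite !modn_small ?ce //; lia.
  rewrite [(1 %% _)%N]modn_small // ce // => E.
  have e1 : (e 1)%:~R * (e 1)%:~R = 1 :> R by rewrite -rmorphM e2.
  rewrite rmorphM rmorphN /=.
  have -> : S%:~R = - (2 * d * (e 1)%:~R) :> R by lra.
  by rewrite mulrNN mulrCA e1 mulr1.
pose a (j : nat) := if j == 0%N then D else 2 * e j.
pose A := \matrix_(i < m.+2, j < m.+2) a ((j + m.+2 - i) %% m.+2)%N.
have AC : map_mx intr A = 2 *: C :> 'M[R]__.
  apply/matrixP => i j; rewrite !mxE Cij /a; case: eqP => [->|/eqP l0]; first by rewrite c0.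
  by rewrite rmorphM /= ce // lt0n l0 ltn_pmod.
(* With n = m + 2, this is 4 (d^2 + n - 1). *)
pose N := D ^+ 2 + 4 * m.+1%:Z.
have AA : A *m A = N%:M.
  suff /matrixP E : map_mx (intr : int -> R) (A *m A) = map_mx intr N%:M.
    by apply/matrixP => i j; have := E i j; rewrite [LHS]mxE [RHS]mxE => /intr_inj.
  rewrite map_mxM AC map_scalar_mx /=.
  rewrite -scalemxAl -scalemxAr -{2}Csym CC scalerA -mul_scalar_mx -scalar_mxM.
  congr _%:M; rewrite /N rmorphD rmorphXn rmorphM /= -dD -!pmulrn; ring.
have D0 : 0 <= D by rewrite -(ler0z R) -dD mulr_ge0.
have Dm : D <= m%:Z.
  apply: le_trans (ler_norm _) (le_trans _ S_le).
  by rewrite normrM normrN /e; case: ifP => _; rewrite ?normrN normr1 mul1r.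
have := int_circulant_order_le (isT : 0 < m.+2)%N _ _ _ AA.
move=> /(_ e) nN.
have {}nN : m.+2%:Z ^+ 2 <= N.
  apply: nN; rewrite /N /a //=; first by nia.
  - by case.
  - by rewrite mulf_neq0 // /e; case: ifP.
(* (m + 2)^2 - 4 (m + 1) = m^2, so m^2 <= D^2, while 0 <= D <= m. *)
have Dm' : D = m by move: nN; rewrite /N; nia.
by rewrite mulrDr dD Dm' mulr1 -addn2 natrD.
Qed.
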